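(* Let $a,b,c$ be real numbers. Let $X=\{X_{i,j},\ i,j\in\mathbb{Z}\}$ be a wide-sense stationary field and $\epsilon=\{\epsilon_{i,j},\ i,j\in\mathbb{Z}\}$ be a collection of uncorrelated zero-mean unit-variance random variables that satisfy $$X_{i,j}=aX_{i-1,j}+bX_{i,j-1}+cX_{i-1,j-1}+\epsilon_{i,j}\qquad\text{for all } i,j\in\mathbb{Z}.$$ If $1+c^2>a^2+b^2$, then $X$ is purely nondeterministic.
   Context: All random variables are real-valued on a probability space $(\Omega,\mathcal{F},\mathsf{P})$. A random field is wide-sense stationary if it has finite second moments, constant mean, and $\operatorname{cov}(X_{i,j},X_{i-h_1,j-h_2})$ depends only on $(h_1,h_2)$. For a family of elements or subspaces of $L^2(\Omega,\mathcal{F},\mathsf{P})$, $\overline{\mathrm{span}}$ denotes the smallest closed linear subspace containing all of them, and $^\bot$ denotes the orthogonal complement in $L^2(\Omega,\mathcal{F},\mathsf{P})$. A field $X$ of finite-variance random variables is called purely nondeterministic if $$\overline{\mathrm{span}}_{i,j}\,X_{i,j}=\overline{\mathrm{span}}_{i,j}\Bigl(\overline{\mathrm{span}}\{X_{r,s}:r\le i\}\cap(\overline{\mathrm{span}}\{X_{r,s}:r<i\})^\bot\cap\overline{\mathrm{span}}\{X_{r,s}:s\le j\}\cap(\overline{\mathrm{span}}\{X_{r,s}:s<j\})^\bot\Bigr),$$ where $i,j$ (and $r,s$, subject to the indicated constraints) range over all integers. *)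

(* Defs.v *)
From HB Require Import structures.
From mathcomp Require Import all_boot all_order all_algebra.
From mathcomp Require Import all_classical all_reals all_analysis.

Set Implicit Arguments.
Unset Strict Implicit.
Unset Printing Implicit Defensive.

Import Order.TTheory GRing.Theory Num.Theory.
Import numFieldNormedType.Exports.

Local Open Scope classical_set_scope.
Local Open Scope ring_scope.

Section HilbertSpaceL2.
Context {d : measure_display} {T : measurableType d} {R : realType}.
Variable P : probability T R.

(* Elements of L^2 are represented by functions rather than by classes modulo
   almost-sure equality. A set that is closed for the L^2 seminorm contains,
   with any function, all its almost-surely equal square-integrable versions,
   so the closed subspaces below are exactly the closed subspaces of the
   quotient space. *)
Definition closed_subspace (V : set (T -> R)) : Prop :=
  [/\ V `<=` [set f | f \in Lfun P 2%:E],
      submod_closed [in V] &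
      forall f : T -> R, f \in Lfun P 2%:E ->
        (forall e : R, 0 < e ->
           exists2 g, V g & ('N[P]_2%:E[EFin \o (f \- g)%R] < e%:E)%E) ->
        V f].

Definition cspan (S : set (T -> R)) : set (T -> R) :=
  smallest closed_subspace S.

Definition orthocompl (S : set (T -> R)) : set (T -> R) :=
  [set f | f \in Lfun P 2%:E /\ forall g, S g -> ('E_P[f * g] = 0)%E].

End HilbertSpaceL2.

Section RandomFields.
Context {d : measure_display} {T : measurableType d} {R : realType}.
Variable P : probability T R.
Implicit Types X eps : int -> int -> {RV P >-> R}.

Definition wide_sense_stationary X : Prop :=
  [/\ forall i j, (X i j : T -> R) \in Lfun P 2%:E,
      forall i j k l, ('E_P[X i j] = 'E_P[X k l])%E &
      forall h1 h2 i j k l : int,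
        covariance P (X i j) (X (i - h1) (j - h2)) =
        covariance P (X k l) (X (k - h1) (l - h2))].

Definition white_noise eps : Prop :=
  [/\ forall i j, (eps i j : T -> R) \in Lfun P 2%:E,
      forall i j, ('E_P[eps i j] = 0)%E,
      forall i j, ('V_P[eps i j] = 1)%E &
      forall i j k l, (i, j) <> (k, l) ->
        covariance P (eps i j) (eps k l) = 0%E].

Definition field_span X (D : int -> int -> Prop) : set (T -> R) :=
  cspan P [set f : T -> R | exists r s, D r s /\ f = X r s].

Definition innovation_space X (i j : int) : set (T -> R) :=
  field_span X (fun r s => r <= i)
  `&` orthocompl P (field_span X (fun r s => r < i))
  `&` field_span X (fun r s => s <= j)
  `&` orthocompl P (field_span X (fun r s => s < j)).

(* Meant for fields with finite second moments: the closed span of a family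
   that is not contained in L^2 is the whole of [T -> R]. *)
Definition purely_nondeterministic X : Prop :=
  field_span X (fun r s => True) =
  cspan P [set f | exists i j, innovation_space X i j f].

End RandomFields.

(* Main.v *)
Require Import Defs.
From HB Require Import structures.
From mathcomp Require Import all_boot all_order all_algebra.
From mathcomp Require Import all_classical all_reals all_analysis.
From mathcomp Require Import complex ring lra zify.

(** Write phi(z1, z2) = 1 - a z1 - b z2 - c z1 z2 and work with the
    non-centred second moments E[X X'], which are shift invariant as well.

    If phi vanished at a point of the torus, the bounded solution
    Re(z1^k z2^l) of the adjoint recursion, multiplied by a logarithmic cutoff
    f on Z^2, would give finite combinations W of the noise with
    E[X_{0,0} W] = f(0) and E[W^2] at most a constant times the Dirichlet energy
    of f. Since Z^2 has zero capacity, this contradicts Cauchy-Schwarz. Hence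
    phi has no zero on the torus, and 1 + c^2 > a^2 + b^2 leaves two cases:
    either phi has no zero in the closed bidisc, or this holds for the symbol
    of coefficients (-b/c, -a/c, 1/c), whose modulus on the torus is |phi|/|c|,
    so that the corresponding filter also turns X into a white noise.

    So let xi be a white noise obtained from X by a filter phi without zero in
    the closed bidisc. The Green function g of phi on the quarter plane has
    rows and columns of geometrically decreasing square norm, because
    (a + c z) / (1 - b z) is bounded by some rho < 1 on the circle. The same
    bound shows that ||Y|| <= K ||phi Y|| for every field Y obtained from X by a
    finite filter. Applied to Y = X - sum_{k,l < n} g_{k,l} xi_{i-k,j-l}, for
    which phi Y only involves the last row and column of g, this gives the
    causal expansion of X in terms of xi. Therefore xi_{i,j} is orthogonal to
    X_{r,s} when r < i or s < j, so that it lies in the innovation space at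
    (i, j), and the xi_{i,j} span X. *)

Set Implicit Arguments.
Unset Strict Implicit.
Unset Printing Implicit Defensive.

Import Order.TTheory GRing.Theory Num.Theory.
Import numFieldNormedType.Exports.

Local Open Scope classical_set_scope.
Local Open Scope ring_scope.

(** * Semi-inner products *)

(** Not definite: the elements of L^2 below are functions, and one that vanishes almost surely has
    norm 0. *)
Definition semi_inner (R : realFieldType) (V : lmodType R) (ip : V -> V -> R) :=
  [/\ forall x y, ip x y = ip y x,
      forall t x y z, ip (t *: x + y) z = t * ip x z + ip y z &
      forall x, 0 <= ip x x].

Section SemiInner.
Context {R : realFieldType} {V : lmodType R} (ip : V -> V -> R).
Hypothesis ip_si : semi_inner ip.

Lemma ipC x y : ip x y = ip y x.
Proof. by have [+ _ _] := ip_si; apply. Qed.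

Lemma ip_ge0 x : 0 <= ip x x.
Proof. by have [_ _] := ip_si; apply. Qed.

Lemma ipDl x y z : ip (x + y) z = ip x z + ip y z.
Proof. by have [_ + _] := ip_si => /(_ 1 x y z); rewrite scale1r mul1r. Qed.

Lemma ip0l z : ip 0 z = 0.
Proof. by apply: (addrI (ip 0 z)); rewrite -ipDl !addr0. Qed.

Lemma ipZl t x z : ip (t *: x) z = t * ip x z.
Proof.
by have [_ + _] := ip_si => /(_ t x 0 z); rewrite addr0 ip0l addr0.
Qed.

Lemma ipDr x y z : ip z (x + y) = ip z x + ip z y.
Proof. by rewrite !(ipC z) ipDl. Qed.

Lemma ipZr t x z : ip z (t *: x) = t * ip z x.
Proof. by rewrite !(ipC z) ipZl. Qed.

Lemma ipNl x z : ip (- x) z = - ip x z.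
Proof. by rewrite -scaleN1r ipZl mulN1r. Qed.

Lemma ipNr x z : ip z (- x) = - ip z x.
Proof. by rewrite !(ipC z) ipNl. Qed.

Definition ipE := (ipDl, ipDr, ipNl, ipNr, ipZl, ipZr).

Lemma ip_suml (I : Type) (r : seq I) (p : pred I) (F : I -> V) z :
  ip (\sum_(i <- r | p i) F i) z = \sum_(i <- r | p i) ip (F i) z.
Proof.
exact: (big_morph (ip^~ z) (fun x y => ipDl x y z) (ip0l z)).
Qed.

Lemma ip_sumr (I : Type) (r : seq I) (p : pred I) (F : I -> V) z :
  ip z (\sum_(i <- r | p i) F i) = \sum_(i <- r | p i) ip z (F i).
Proof. by rewrite ipC ip_suml; apply: eq_bigr => i _; rewrite ipC. Qed.

Lemma ip_amgm (t : R) x y : 0 < t -> 2 * ip x y <= t * ip x x + t^-1 * ip y y.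
Proof.
move=> t0; have := ip_ge0 (t *: x - y); rewrite !ipE (ipC y x) => h.
rewrite -subr_ge0 -(pmulr_rge0 _ t0).
rewrite [leRHS](_ : _ = t * (t * ip x x - ip x y) - (t * ip x y - ip y y)).
  by lra.
by field; rewrite gt_eqF.
Qed.

Lemma ip_cauchy_schwarz x y : ip x y ^+ 2 <= ip x x * ip y y.
Proof.
have key t : 0 <= ip x x - 2 * t * ip x y + t ^+ 2 * ip y y.
  by have := ip_ge0 (x - t *: y); rewrite !ipE (ipC y x); lra.
have [y0|y0] := eqVneq (ip y y) 0; last first.
  have yp : 0 < ip y y by rewrite lt0r y0 ip_ge0.
  have := key (ip x y / ip y y); rewrite -(pmulr_rge0 _ yp).
  rewrite [X in 0 <= X -> _](_ : _ = ip x x * ip y y - ip x y ^+ 2).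
    by rewrite subr_ge0.
  by field.
have [->|xy0] := eqVneq (ip x y) 0; first by rewrite expr0n mulr_ge0 ?ip_ge0.
(* With [ip y y = 0] the bound [key] is affine in [t]; this [t] gives it the value -1. *)
have := key ((ip x x + 1) / (2 * ip x y)).
rewrite y0 mulr0 addr0 [X in 0 <= X](_ : _ = -1) ?ler0N1 //.
by field.
Qed.

Lemma ip_sumsq4 x y z w :
  ip (x + y + z + w) (x + y + z + w) <=
  4 * (ip x x + ip y y + ip z z + ip w w).
Proof.
have h u v : 2 * ip u v <= ip u u + ip v v.
  by have := ip_amgm u v (@ltr01 R); rewrite invr1 !mul1r.
have := (h x y, h x z, h x w, h y z, h y w, h z w).
rewrite !ipE (ipC y x) (ipC z x) (ipC w x) (ipC z y) (ipC w y) (ipC w z).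
case=> [[[[[h1 h2] h3] h4] h5] h6]; lra.
Qed.

Lemma ip_orthosum (I : finType) (E : I -> V) (g : I -> R) s :
    (forall k l, ip (E k) (E l) = if k == l then s else 0) ->
  ip (\sum_k g k *: E k) (\sum_k g k *: E k) = s * \sum_k g k ^+ 2.
Proof.
move=> hE; rewrite ip_suml mulr_sumr; apply: eq_bigr => k _.
rewrite ip_sumr (bigD1 k) //= big1 => [|l lk].
  by rewrite !ipE hE eqxx; ring.
by rewrite !ipE hE eq_sym (negbTE lk) !mulr0.
Qed.

End SemiInner.

(** * The Green function of a stable quarter-plane filter *)

Section Green.
Context {R : realFieldType}.
Implicit Types (a b c r : R) (w : nat -> R).

(* Indices are shifted by one: green k.+1 l.+1 is the coefficient of z1^k z2^l in
   1 / (1 - a z1 - b z2 - c z1 z2), and row 0 and column 0 vanish. *)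
Fixpoint green_row a b c (d : R) (v : nat -> R) (l : nat) : R :=
  if l is l'.+1 then
    (if l' is 0 then d else 0) + a * v l'.+1
    + b * green_row a b c d v l' + c * v l'
  else 0.

Fixpoint green a b c (k : nat) : nat -> R :=
  if k is k'.+1 then
    green_row a b c (if k' is 0 then 1 else 0) (green a b c k')
  else fun=> 0.

Lemma green0l a b c l : green a b c 0 l = 0.
Proof. by []. Qed.

Lemma greenk0 a b c k : green a b c k 0 = 0.
Proof. by case: k. Qed.

Lemma greenSS a b c k l :
  green a b c k.+1 l.+1 =
  ((k == 0) && (l == 0))%:R + a * green a b c k l.+1
  + b * green a b c k.+1 l + c * green a b c k l.
Proof. by case: k => [|k]; case: l => [|l]. Qed.

Lemma green_sym a b c k l : green a b c k l = green b a c l k.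
Proof.
elim: k l => [|k IHk] l; first by rewrite greenk0.
elim: l => [|l IHl]; first by rewrite greenk0.
by rewrite !greenSS IHk IHl IHk andbC; ring.
Qed.

(** On the circle, r |1 - b z|^2 - |a + c z|^2 is affine in Re z, so its sign is decided at z = 1
    and z = -1, where the hypotheses give it. *)
Lemma contraction_form a b c r : 0 <= r -> `|b| < 1 ->
    (a + c) ^+ 2 <= r * (1 - b) ^+ 2 -> (a - c) ^+ 2 <= r * (1 + b) ^+ 2 ->
  [/\ 2 * `|r * b + a * c| <= (r - a ^+ 2) + (r * b ^+ 2 - c ^+ 2) &
      `|r * b + a * c| <= r - a ^+ 2].
Proof.
move=> r0 b1 h1 h2.
have H : 2 * `|r * b + a * c| <= (r - a ^+ 2) + (r * b ^+ 2 - c ^+ 2).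
  by case: (ler0P (r * b + a * c)) => _; lra.
split=> //.
have b2 : 0 <= 1 - b ^+ 2 by rewrite subr_ge0 -real_normK ?num_real// expr_le1// ltW.
(* It implies [r * b ^+ 2 - c ^+ 2 <= r - a ^+ 2], so that [H] yields the second bound. Squared, it
   is the product of the two hypotheses. *)
suff K : `|a ^+ 2 - c ^+ 2| <= r * (1 - b ^+ 2).
  by have := ler_norm (a ^+ 2 - c ^+ 2); lra.
rewrite -(@ler_pXn2r _ 2)// ?nnegrE ?mulr_ge0// real_normK ?num_real//.
have -> : (a ^+ 2 - c ^+ 2) ^+ 2 = (a + c) ^+ 2 * (a - c) ^+ 2 by ring.
have -> : (r * (1 - b ^+ 2)) ^+ 2 = (r * (1 - b) ^+ 2) * (r * (1 + b) ^+ 2) by ring.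
by apply: ler_pM; rewrite ?sqr_ge0.
Qed.

(* The boundary terms have the right sign because the Moebius filter
   (a + c S) / (1 - b S), where S is the shift, is causal. *)
Lemma contraction_sum a b c r w n : 0 <= r -> `|b| < 1 ->
    (a + c) ^+ 2 <= r * (1 - b) ^+ 2 -> (a - c) ^+ 2 <= r * (1 + b) ^+ 2 ->
    w 0 = 0 ->
  \sum_(l < n) (a * w l.+1 + c * w l) ^+ 2 <=
  r * \sum_(l < n) (w l.+1 - b * w l) ^+ 2.
Proof.
move=> r0 b1 h1 h2 w0; have [H1 H2] := contraction_form r0 b1 h1 h2.
set B := r * b + a * c in H1 H2.
suff : (r - a ^+ 2 - `|B|) * w n ^+ 2 <=
    r * (\sum_(l < n) (w l.+1 - b * w l) ^+ 2)
      - \sum_(l < n) (a * w l.+1 + c * w l) ^+ 2.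
  move=> H; rewrite -subr_ge0; apply: le_trans H.
  by rewrite mulr_ge0 ?subr_ge0 ?sqr_ge0.
elim: n => [|n IH]; first by rewrite !big_ord0 w0 expr0n /= !mulr0 subrr.
rewrite !big_ord_recr /=; set u := w n; set v := w n.+1.
have K : 2 * B * u * v <= `|B| * (u ^+ 2 + v ^+ 2).
  have -> : 2 * B * u * v = B * (2 * u * v) by ring.
  apply: (le_trans (ler_norm _)); rewrite normrM ler_wpM2l //.
  have := sqr_ge0 (u - v); have := sqr_ge0 (u + v).
  by case: (ler0P (2 * u * v)) => _; lra.
have L : 0 <= (r - a ^+ 2 + (r * b ^+ 2 - c ^+ 2) - 2 * `|B|) * u ^+ 2.
  by rewrite mulr_ge0 ?sqr_ge0// subr_ge0.
move: IH K L; rewrite -/u /B; set SA := \sum_(l < n) _; set SB := \sum_(l < n) _.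
move: `|_| => z; lra.
Qed.

(** On sequences starting at 0, 1 - b S has an inverse of norm at most 1 / (1 - |b|). The induction
    carries a multiple of [w n ^+ 2], which absorbs the next cross term. *)
Lemma causal_inverse_sum b w n : `|b| < 1 -> w 0 = 0 ->
  (1 - `|b|) ^+ 2 * \sum_(l < n) w l.+1 ^+ 2 <=
  \sum_(l < n) (w l.+1 - b * w l) ^+ 2.
Proof.
move=> b1 w0.
suff : (1 - `|b|) ^+ 2 * \sum_(l < n) w l.+1 ^+ 2
    + `|b| * (1 - `|b|) * w n ^+ 2 <= \sum_(l < n) (w l.+1 - b * w l) ^+ 2.
  by apply: le_trans; rewrite lerDl mulr_ge0 ?sqr_ge0// mulr_ge0// subr_ge0 ltW.
elim: n => [|n IH]; first by rewrite !big_ord0 w0 expr0n /= !mulr0 addr0.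
rewrite !big_ord_recr /=; set u := w n; set v := w n.+1.
have K : 2 * b * u * v <= `|b| * (u ^+ 2 + v ^+ 2).
  have -> : 2 * b * u * v = b * (2 * u * v) by ring.
  apply: (le_trans (ler_norm _)); rewrite normrM ler_wpM2l //.
  have := sqr_ge0 (u - v); have := sqr_ge0 (u + v).
  by case: (ler0P (2 * u * v)) => _; lra.
have E : b ^+ 2 = `|b| ^+ 2 by rewrite real_normK ?num_real.
move: IH K; rewrite -/u; set SA := \sum_(l < n) _; set SB := \sum_(l < n) _.
have -> : (v - b * u) ^+ 2 = v ^+ 2 - 2 * b * u * v + b ^+ 2 * u ^+ 2 by ring.
rewrite E; move: `|b| => z; lra.
Qed.

(** Consecutive rows satisfy (1 - b S) row' = (a + c S) row, so by [contraction_sum] the square norm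
    of (1 - b S) row shrinks by [r] at each step, starting from a unit impulse. *)
Lemma green_row_bound a b c r k n : 0 <= r -> `|b| < 1 ->
    (a + c) ^+ 2 <= r * (1 - b) ^+ 2 -> (a - c) ^+ 2 <= r * (1 + b) ^+ 2 ->
  (1 - `|b|) ^+ 2 * \sum_(l < n) green a b c k.+1 l.+1 ^+ 2 <= r ^+ k.
Proof.
move=> r0 b1 h1 h2.
apply: le_trans (causal_inverse_sum _ _ _) _; rewrite ?greenk0//.
elim: k => [|k IH].
  case: n => [|n]; first by rewrite big_ord0 expr0.
  rewrite big_ord_recl big1 ?addr0 => [|i _]; rewrite !greenSS ?greenk0 ?green0l /=.
    by rewrite expr0; lra.
  by rewrite /bump /=; ring.
rewrite exprS; apply: le_trans (ler_wpM2l r0 IH).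
apply: le_trans (contraction_sum _ r0 b1 h1 h2 _); rewrite ?greenk0//.
rewrite le_eqVlt; apply/orP; left; apply/eqP; apply: eq_bigr => i _.
by rewrite greenSS /=; ring.
Qed.

Lemma green_row_bound_shift a b c r k n : 0 <= r -> `|b| < 1 ->
    (a + c) ^+ 2 <= r * (1 - b) ^+ 2 -> (a - c) ^+ 2 <= r * (1 + b) ^+ 2 ->
  (1 - `|b|) ^+ 2 * \sum_(l < n) green a b c k.+1 l ^+ 2 <= r ^+ k.
Proof.
move=> r0 b1 h1 h2; apply: le_trans (green_row_bound k n r0 b1 h1 h2).
rewrite ler_wpM2l ?sqr_ge0//.
case: n => [|n]; first by rewrite !big_ord0.
rewrite big_ord_recl greenk0 expr0n add0r big_ord_recr /=.
by rewrite lerDl sqr_ge0.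
Qed.

End Green.

Definition ar_filter {R : nzRingType} {V : lmodType R} (a b c : R)
    (X : int -> int -> V) (i j : int) : V :=
  X i j - a *: X (i - 1) j - b *: X i (j - 1) - c *: X (i - 1) (j - 1).

Section GreenTelescope.
Context {R : realFieldType} {V : lmodType R}.

Lemma telescope_ord (F : nat -> V) n :
  \sum_(k < n) (F k - F k.+1) = F 0 - F n.
Proof.
rewrite -(big_mkord xpredT (fun k => F k - F k.+1)) -opprB.
by rewrite -(telescope_sumr F (leq0n n)) -sumrN; apply: eq_bigr => k _; rewrite opprB.
Qed.

(** Abel summation: by [greenSS] everything cancels except [E 0 0] and the terms crossing the far
    edges of the square. The near edges give nothing, since row 0 and column 0 of [green] vanish. *)
Lemma green_telescope (a b c : R) (E : nat -> nat -> V) n :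
  let g := green a b c in
  \sum_(k < n.+1) \sum_(l < n.+1) g k.+1 l.+1 *:
    (E k l - a *: E k.+1 l - b *: E k l.+1 - c *: E k.+1 l.+1) =
  E 0 0 - (a *: (\sum_(l < n.+1) g n.+1 l.+1 *: E n.+1 l)
         + b *: (\sum_(k < n.+1) g k.+1 n.+1 *: E k n.+1)
         + c *: (\sum_(l < n.+1) g n.+1 l *: E n.+1 l)
         + c *: (\sum_(k < n.+1) g k.+1 n.+1 *: E k.+1 n.+1)).
Proof.
move=> g.
(* The diagonal difference is split into a step in [k] and a step in [l], so that each bracket
   telescopes in one index. *)
have term k l : g k.+1 l.+1 *:
    (E k l - a *: E k.+1 l - b *: E k l.+1 - c *: E k.+1 l.+1) =
    ((k == 0) && (l == 0))%:R *: E k l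
    + a *: (g k l.+1 *: E k l - g k.+1 l.+1 *: E k.+1 l)
    + b *: (g k.+1 l *: E k l - g k.+1 l.+1 *: E k l.+1)
    + c *: (g k l *: E k l - g k.+1 l *: E k.+1 l)
    + c *: (g k.+1 l *: E k.+1 l - g k.+1 l.+1 *: E k.+1 l.+1).
  set d := _%:R; have gE : g k.+1 l.+1 =
     d + a * g k l.+1 + b * g k.+1 l + c * g k l by exact: greenSS.
  rewrite !scalerBr !scalerA {1}gE !scalerDl !(mulrC (g k.+1 l.+1)).
  by rewrite !addrA subrK [RHS](ACl (1*2*4*6*3*5*7)).
under eq_bigr => k _ do under eq_bigr => l _ do rewrite term.
under eq_bigr do rewrite !big_split /=.
rewrite !big_split /= -!addrA; congr (_ + _).
  rewrite big_ord_recl big_ord_recl /= scale1r !big1 ?addr0 // => k _.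
    by rewrite big1 // => l _; rewrite scale0r.
  by rewrite scale0r.
rewrite !opprD -!scalerN; congr (_ + (_ + (_ + _))).
- rewrite exchange_big /=; under eq_bigr do rewrite -scaler_sumr.
  rewrite -scaler_sumr; congr (_ *: _); rewrite -sumrN; apply: eq_bigr => l _.
  by rewrite (telescope_ord (fun k => g k l.+1 *: E k l)) scale0r sub0r.
- under eq_bigr do rewrite -scaler_sumr.
  rewrite -scaler_sumr; congr (_ *: _); rewrite -sumrN; apply: eq_bigr => k _.
  by rewrite (telescope_ord (fun l => g k.+1 l *: E k l)) /g greenk0 scale0r sub0r.
- rewrite exchange_big /=; under eq_bigr do rewrite -scaler_sumr.
  rewrite -scaler_sumr; congr (_ *: _); rewrite -sumrN; apply: eq_bigr => l _.
  by rewrite (telescope_ord (fun k => g k l *: E k l)) scale0r sub0r.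
- under eq_bigr do rewrite -scaler_sumr.
  rewrite -scaler_sumr; congr (_ *: _); rewrite -sumrN; apply: eq_bigr => k _.
  by rewrite (telescope_ord (fun l => g k.+1 l *: E k.+1 l)) /g greenk0 scale0r sub0r.
Qed.

End GreenTelescope.

(** * Stationary fields *)

Definition white {R : realFieldType} {V : lmodType R} (ip : V -> V -> R) (s : R)
    (E : int -> int -> V) :=
  forall i j k l, ip (E i j) (E k l) = if (i == k) && (j == l) then s else 0.

Section Fields.
Context {R : realFieldType} {V : lmodType R} (ip : V -> V -> R).
Hypothesis ip_si : semi_inner ip.
Implicit Types X Y Z : int -> int -> V.

Definition jointly_stationary X Y := forall i j k l m n,
  ip (X (i + m) (j + n)) (Y (k + m) (l + n)) = ip (X i j) (Y k l).

(** The images of [X] under finite filters, generated so that stationarity passes to them by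
    induction. *)
Inductive filtered X : (int -> int -> V) -> Prop :=
| filtered_id : filtered X X
| filtered_lin t Y Z W : filtered X Y -> filtered X Z ->
    (forall i j, W i j = t *: Y i j + Z i j) -> filtered X W
| filtered_shift m n Y W : filtered X Y ->
    (forall i j, W i j = Y (i + m) (j + n)) -> filtered X W.

Lemma filtered_stationary2 X Y Z : jointly_stationary X Z ->
  filtered X Y -> jointly_stationary Y Z.
Proof.
move=> XZ; elim=> {Y} [//|t Y Y' W _ IHY _ IHY' WE|m n Y W _ IH WE] i j k l p q.
  by rewrite !WE !(ipE ip_si) IHY IHY'.
by rewrite !WE -(IH (i + m) (j + n) k l p q); congr (ip (Y _ _) _); ring.
Qed.

Lemma jointly_stationaryC X Y :
  jointly_stationary X Y -> jointly_stationary Y X.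
Proof. by move=> h i j k l m n; rewrite !(ipC ip_si (Y _ _)). Qed.

Lemma filtered_stationary X Y : jointly_stationary X X ->
  filtered X Y -> jointly_stationary Y Y.
Proof.
move=> XX XY; apply: (filtered_stationary2 _ XY); apply: jointly_stationaryC.
exact: filtered_stationary2 XY.
Qed.

Lemma filtered0 X : filtered X (fun _ _ => 0).
Proof.
apply: (filtered_lin (t := -1) (filtered_id X) (filtered_id X)) => i j.
by rewrite scaleN1r addNr.
Qed.

Lemma filteredZ X Y t : filtered X Y -> filtered X (fun i j => t *: Y i j).
Proof.
by move=> hY; apply: (filtered_lin hY (filtered0 X)) => i j; rewrite addr0.
Qed.

Lemma filteredB X Y Z : filtered X Y -> filtered X Z ->
  filtered X (fun i j => Y i j - Z i j).
Proof.
move=> hY hZ; apply: (filtered_lin (t := -1) hZ hY) => i j.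
by rewrite scaleN1r addrC.
Qed.

Lemma filteredS X Y m n : filtered X Y ->
  filtered X (fun i j => Y (i + m) (j + n)).
Proof. by move=> hY; apply: (filtered_shift hY). Qed.

Lemma filtered_sum X N (F : 'I_N -> int -> int -> V) :
  (forall k, filtered X (F k)) -> filtered X (fun i j => \sum_(k < N) F k i j).
Proof.
elim: N F => [|N IH] F hF.
  apply: (filtered_lin (t := 0) (filtered0 X) (filtered0 X)) => i j.
  by rewrite big_ord0 scaler0 addr0.
apply: (filtered_lin (t := 1) (IH (fun k => F (widen_ord (leqnSn N) k)) _) (hF ord_max)).
  by move=> k; apply: hF.
by move=> i j; rewrite big_ord_recr scale1r.
Qed.

Lemma filtered_ar X Y a b c : filtered X Y -> filtered X (ar_filter a b c Y).
Proof.
move=> hY; rewrite /ar_filter.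
apply: filteredB; last exact/filteredZ/filteredS.
apply: filteredB; last first.
  apply: filteredZ; apply: (filtered_shift (m := 0) (n := -1) hY) => i j.
  by rewrite addr0.
apply: filteredB => //.
apply: filteredZ; apply: (filtered_shift (m := -1) (n := 0) hY) => i j.
by rewrite addr0.
Qed.

(** Split the filtered field as Z - U with Z = (1 - b S2) Y and U = S1 (a + c S2) Y. By stationarity
    their square norms only involve the variance and one covariance of [Y], so [contraction_form]
    gives |U|^2 <= r |Z|^2. *)
Lemma ar_coercive a b c r Y : 0 <= r < 1 -> `|b| < 1 ->
    (a + c) ^+ 2 <= r * (1 - b) ^+ 2 -> (a - c) ^+ 2 <= r * (1 + b) ^+ 2 ->
    jointly_stationary Y Y -> forall i j,
  ((1 - `|b|) * (1 - r) / 2) ^+ 2 * ip (Y i j) (Y i j) <=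
  ip (ar_filter a b c Y i j) (ar_filter a b c Y i j).
Proof.
move=> /andP[r0 r1] b1 h1 h2 YY i j.
pose y := ip (Y i j) (Y i j); pose x := ip (Y i j) (Y i (j - 1)).
have y0 : 0 <= y by exact: ip_ge0.
have yE k l : ip (Y k l) (Y k l) = y.
  rewrite /y -(YY k l k l (i - k) (j - l)); congr (ip (Y _ _) (Y _ _)); ring.
have xE k l : ip (Y k l) (Y k (l - 1)) = x.
  rewrite /x -(YY k l k (l - 1) (i - k) (j - l)); congr (ip (Y _ _) (Y _ _)); ring.
have xE' k l : ip (Y k (l - 1)) (Y k l) = x by rewrite (ipC ip_si) xE.
have xy : - y <= x <= y.
  have := ip_ge0 ip_si (Y i j - Y i (j - 1)).
  have := ip_ge0 ip_si (Y i j + Y i (j - 1)).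
  by rewrite !(ipE ip_si) !yE xE xE' => ? ?; apply/andP; split; lra.
pose Z := Y i j - b *: Y i (j - 1).
pose U := a *: Y (i - 1) j + c *: Y (i - 1) (j - 1).
have ZE : ip Z Z = (1 + b ^+ 2) * y - 2 * b * x.
  by rewrite /Z !(ipE ip_si) !yE xE xE'; ring.
have UE : ip U U = (a ^+ 2 + c ^+ 2) * y + 2 * a * c * x.
  by rewrite /U !(ipE ip_si) !yE xE xE'; ring.
have UZ : ip U U <= r * ip Z Z.
  have [H1 _] := contraction_form r0 b1 h1 h2.
  rewrite ZE UE -subr_ge0.
  set B := r * b + a * c in H1.
  rewrite [X in 0 <= X](_ : _ =
    ((r - a ^+ 2) + (r * b ^+ 2 - c ^+ 2)) * y - 2 * B * x); last by rewrite /B; ring.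
  have K : B * x <= `|B| * y.
    apply: (le_trans (ler_norm _)); rewrite normrM ler_wpM2l // ler_norml.
    by [].
  have := ler_wpM2r y0 H1; lra.
have YZ : (1 - `|b|) ^+ 2 * y <= ip Z Z.
  have K : b * x <= `|b| * y.
    apply: (le_trans (ler_norm _)); rewrite normrM ler_wpM2l // ler_norml.
    by [].
  have E : b ^+ 2 = `|b| ^+ 2 by rewrite real_normK ?num_real.
  by rewrite ZE E; lra.
have -> : ar_filter a b c Y i j = Z - U.
  by rewrite /ar_filter /Z /U !opprD !addrA [LHS](ACl (1*3*2*4)).
(* The best weight is the square root of [r]; the arithmetic mean of 1 and [r] replaces it
   rationally. *)
clearbody Z U; pose t := (1 + r) / 2.
have t0 : 0 < t by rewrite /t; lra.
have := ip_amgm ip_si Z U t0; rewrite !(ipE ip_si) (ipC ip_si U Z).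
have Z0 := ip_ge0 ip_si Z; have U0 := ip_ge0 ip_si U.
set z := ip Z Z in UZ YZ Z0 *; set u := ip U U in UZ U0 *; set w := ip Z U => H.
have s1 : 1 <= t^-1 by rewrite invf_ge1 // /t; lra.
have K1 : (1 - t) * (1 - r * t^-1) * z <= z - w + (- w - - u).
  have := ler_wpM2l (_ : 0 <= t^-1 - 1) UZ; rewrite subr_ge0 => /(_ s1).
  have -> : (1 - t) * (1 - r * t^-1) = 1 - t - r * t^-1 + r.
    by field; rewrite gt_eqF.
  by move: H; set s := t^-1; lra.
apply: le_trans K1.
have K2 : ((1 - r) / 2) ^+ 2 <= (1 - t) * (1 - r * t^-1).
  have -> : 1 - r * t^-1 = (1 - r) / 2 * t^-1.
    rewrite /t; field; lra.
  have -> : 1 - t = (1 - r) / 2 by rewrite /t; field.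
  by rewrite mulrA -expr2 ler_peMr// sqr_ge0.
apply: le_trans (ler_wpM2r Z0 K2).
have -> : ((1 - `|b|) * (1 - r) / 2) ^+ 2 * ip (Y i j) (Y i j) =
  ((1 - r) / 2) ^+ 2 * ((1 - `|b|) ^+ 2 * y) by rewrite -/y; field.
by rewrite ler_wpM2l ?sqr_ge0.
Qed.

End Fields.

(** * No zero of the symbol on the torus *)

Section LogCutoff.
Context {R : realType}.

(** A discrete log(N / m), equal to a harmonic number at 0. *)
Definition log_cutoff N m : R := \sum_(m <= j < N) j.+1%:R^-1.

Lemma log_cutoff_ge N m : (N <= m)%N -> log_cutoff N m = 0.
Proof. exact: big_geq. Qed.

Lemma log_cutoff_stepS N m :
  `|log_cutoff N m.+1 - log_cutoff N m| <= m.+1%:R^-1.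
Proof.
rewrite /log_cutoff; have [Nm|mN] := leqP N m.
  by rewrite !big_geq ?subr0 ?normr0 ?invr_ge0 ?(leq_trans Nm).
rewrite [X in _ - X]big_ltn // opprD addrCA subrr addr0 normrN.
by rewrite ger0_norm ?invr_ge0.
Qed.

Lemma log_cutoff_stepD N m d :
  `|log_cutoff N (m + d) - log_cutoff N m| <= d%:R / m.+1%:R.
Proof.
elim: d => [|d IH]; first by rewrite addn0 subrr normr0 mul0r.
rewrite addnS -[X in `|X|](subrKA (log_cutoff N (m + d))) -[in leRHS]natr1 mulrDl.
rewrite addrC; apply: (le_trans (ler_normD _ _)); apply: lerD => //.
apply: (le_trans (log_cutoff_stepS _ _)).
by rewrite mul1r lef_pV2 ?posrE ?ler_nat ?ltnS ?leq_addr.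
Qed.

(** A diagonal move changes |k| + |l| by at most 2. The constant is 2 * 3, as [m.+1] is at most
    three times [m'.+1]. *)
Lemma log_cutoff_step N m m' : (m' <= m + 2)%N -> (m <= m' + 2)%N ->
  `|log_cutoff N m' - log_cutoff N m| <= 6 / m.+1%:R.
Proof.
move=> h1 h2; have [mm'|m'm] := leqP m m'.
  rewrite -(subnKC mm'); apply: (le_trans (log_cutoff_stepD _ _ _)).
  by rewrite ler_pM2r ?invr_gt0 // ler_nat; lia.
rewrite distrC -(subnKC (ltnW m'm)); apply: (le_trans (log_cutoff_stepD _ _ _)).
rewrite subnKC ?(ltnW m'm) // ler_pdivrMr // mulrAC ler_pdivlMr // -!natrM ler_nat.
nia.
Qed.

Lemma sum_sym_le (F : nat -> R) N : (forall m, 0 <= F m) ->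
  \sum_(i < N + N.+1) F `|i%:Z - N%:Z|%N <= 2 * \sum_(i < N.+1) F i.
Proof.
move=> F0; rewrite big_split_ord /= mulrDl !mul1r; apply: lerD; last first.
  rewrite le_eqVlt; apply/orP; left; apply/eqP; apply: eq_bigr => i _.
  by congr F; lia.
rewrite [leRHS]big_ord_recl; apply: (le_trans _ (ler_wpDl (F0 _) (lexx _))).
rewrite (reindex_inj rev_ord_inj) /= le_eqVlt; apply/orP; left; apply/eqP.
by apply: eq_bigr => i _; congr F; rewrite /bump /=; have := ltn_ord i; lia.
Qed.

(** Telescoping: 1 / x^2 <= 2 / x - 2 / (x + 1) for x >= 1. *)
Lemma sum_inv_sqr_le p n :
  \sum_(l < n) (p + l).+1%:R^-1 ^+ 2 <= 2 / p.+1%:R :> R.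
Proof.
suff : \sum_(l < n) (p + l).+1%:R^-1 ^+ 2 <= 2 / p.+1%:R - 2 / (p + n).+1%:R :> R.
  by move=> /le_trans; apply; rewrite gerBl divr_ge0.
elim: n => [|n IH]; first by rewrite big_ord0 addn0 subrr.
rewrite big_ord_recr /= addnS.
set x := (p + n).+1%:R : R; have x1 : 1 <= x by rewrite ler1n.
have -> : (p + n).+2%:R = x + 1 :> R by rewrite -natr1.
have K : x^-1 ^+ 2 <= 2 / x - 2 / (x + 1).
  rewrite -subr_ge0 [X in 0 <= X](_ : _ = (x - 1) / (x ^+ 2 * (x + 1))).
    by rewrite divr_ge0 ?subr_ge0 // mulr_ge0 ?sqr_ge0; lra.
  by field; apply/andP; split; lra.
by apply: (le_trans (lerD IH K)); rewrite addrA subrK.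
Qed.

(** The left side dominates the energy of the cutoff up to a constant. It grows linearly, not
    quadratically, in the height of the cutoff at 0: this is the zero capacity of Z^2. *)
Lemma box_energy N :
  \sum_(i < N + N.+1) \sum_(j < N + N.+1)
    ((`|i%:Z - N%:Z| + `|j%:Z - N%:Z|)%N.+1%:R^-1 ^+ 2) <=
  8 * \sum_(m < N.+1) m.+1%:R^-1 :> R.
Proof.
have inner p : \sum_(j < N + N.+1) ((p + `|j%:Z - N%:Z|)%N.+1%:R^-1 ^+ 2) <=
    4 / p.+1%:R :> R.
  apply: (le_trans (sum_sym_le (F := fun m => (p + m).+1%:R^-1 ^+ 2) _ _)).
    by move=> m; rewrite sqr_ge0.
  apply: (le_trans (ler_wpM2l _ (sum_inv_sqr_le p N.+1))) => //.
  by rewrite mulrA -natrM.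
apply: (le_trans (ler_sum _ (fun i _ => inner _))).
apply: (le_trans (sum_sym_le (F := fun m => 4 / m.+1%:R) _ _)).
  by move=> m; rewrite divr_ge0.
by rewrite -mulr_sumr mulrA -natrM.
Qed.

Lemma harmonic_unbounded (C : R) : exists N, C < \sum_(j < N) j.+1%:R^-1.
Proof.
apply: contrapT => h; apply: (@dvg_harmonic R).
apply: nondecreasing_is_cvgn.
  apply/nondecreasing_seqP => n; rewrite /series /= big_nat_recr //=.
  by rewrite lerDl.
exists C => _ [n _ <-]; rewrite /series /= big_mkord leNgt; apply/negP => hn.
by apply: h; exists n.
Qed.

End LogCutoff.

Lemma sum_shift {V : nmodType} (F : nat -> V) n : F 0 = 0 -> F n = 0 ->
  \sum_(i < n) F i.+1 = \sum_(i < n) F i.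
Proof.
move=> F0 Fn; transitivity (\sum_(i < n.+1) F i).
  by rewrite big_ord_recl F0 add0r.
by rewrite big_ord_recr /= Fn addr0.
Qed.

(** * Summation by parts on the square [-N, N]^2 *)

Section SumByParts.
Context {R : realFieldType}.

Definition box_sum N (F : int -> int -> R) : R :=
  \sum_(i < N + N.+1) \sum_(j < N + N.+1) F (i%:Z - N%:Z) (j%:Z - N%:Z).

Lemma box_sum_shift N s t (F : int -> int -> R) : (s <= 1)%N -> (t <= 1)%N ->
    (forall k l, (N <= `|k| + `|l|)%N -> F k l = 0) ->
  box_sum N (fun k l => F (k + s%:Z) (l + t%:Z)) = box_sum N F.
Proof.
move=> s1 t1 F0; rewrite /box_sum.
have colE k : \sum_(j < N + N.+1) F k (j%:Z - N%:Z + t%:Z) =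
              \sum_(j < N + N.+1) F k (j%:Z - N%:Z).
  case: t t1 => [|[|//]] _; first by apply: eq_bigr => j _; rewrite addr0.
  rewrite -(sum_shift (F := fun j => F k (j%:Z - N%:Z))).
  - by apply: eq_bigr => j _; congr F; lia.
  - by apply: F0; lia.
  - by apply: F0; lia.
under eq_bigr do rewrite colE.
case: s s1 => [|[|//]] _; first by apply: eq_bigr => i _; rewrite addr0.
rewrite -(sum_shift (F := fun i => \sum_(j < N + N.+1) F (i%:Z - N%:Z) (j%:Z - N%:Z))).
- by apply: eq_bigr => i _; apply: eq_bigr => j _; congr F; lia.
- by rewrite big1 // => j _; apply: F0; lia.
- by rewrite big1 // => j _; apply: F0; lia.
Qed.

Lemma box_sum_adjoint N (a b c : R) (v u : int -> int -> R) :
    (forall k l, (N <= `|k| + `|l|)%N -> v k l = 0) ->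
  box_sum N (fun k l => (v k l - a * v (k + 1) l - b * v k (l + 1)
                         - c * v (k + 1) (l + 1)) * u k l) =
  box_sum N (fun k l => v k l *
    (u k l - a * u (k - 1) l - b * u k (l - 1) - c * u (k - 1) (l - 1))).
Proof.
move=> v0.
have sh s t : (s <= 1)%N -> (t <= 1)%N ->
    box_sum N (fun k l => v (k + s%:Z) (l + t%:Z) * u k l) =
    box_sum N (fun k l => v k l * u (k - s%:Z) (l - t%:Z)).
  move=> s1 t1.
  rewrite -(box_sum_shift (F := fun k l => v k l * u (k - s%:Z) (l - t%:Z)) s1 t1).
    by apply: eq_bigr => i _; apply: eq_bigr => j _; rewrite !addrK.
  by move=> k l kl; rewrite v0 ?mul0r.
have h1 := sh 1 0 isT isT; have h2 := sh 0 1 isT isT; have h3 := sh 1 1 isT isT.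
have lin (F0 F1 F2 F3 : int -> int -> R) :
    box_sum N (fun k l => F0 k l - a * F1 k l - b * F2 k l - c * F3 k l) =
    box_sum N F0 - a * box_sum N F1 - b * box_sum N F2 - c * box_sum N F3.
  by rewrite /box_sum !mulr_sumr -!sumrB; apply: eq_bigr => i _;
    rewrite !mulr_sumr -!sumrB.
transitivity (box_sum N (fun k l => v k l * u k l - a * (v (k + 1%:Z) (l + 0%:Z) * u k l)
   - b * (v (k + 0%:Z) (l + 1%:Z) * u k l) - c * (v (k + 1%:Z) (l + 1%:Z) * u k l))).
  by apply: eq_bigr => i _; apply: eq_bigr => j _; rewrite !addr0; ring.
rewrite lin h1 h2 h3 -lin.
by apply: eq_bigr => i _; apply: eq_bigr => j _; rewrite !subr0; ring.
Qed.

End SumByParts.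

(** * The capacity argument *)

Section NoBoundedKernel.
Context {R : realType} {V : lmodType R} (ip : V -> V -> R).
Hypothesis ip_si : semi_inner ip.

Lemma no_bounded_kernel (a b c : R) (X : int -> int -> V) (g : int -> int -> R) :
    jointly_stationary ip X X -> white ip 1 (ar_filter a b c X) ->
    (forall k l, `|g k l| <= 1) ->
    (forall k l, g k l = a * g (k + 1) l + b * g k (l + 1)
                         + c * g (k + 1) (l + 1)) ->
  g 0 0 <> 1.
Proof.
move=> XX ew g1 gE g00.
pose eta := ar_filter a b c X; pose u k l := ip (X 0 0) (eta (- k) (- l)).
have XE : jointly_stationary ip X eta.
  apply/(jointly_stationaryC ip_si)/(filtered_stationary2 ip_si XX).
  exact/filtered_ar/filtered_id.
(* Filtering [u] amounts to filtering [X 0 0], which gives [eta 0 0], and [eta] is white. *)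
have uE k l : u k l - a * u (k - 1) l - b * u k (l - 1) - c * u (k - 1) (l - 1) =
    ((k == 0) && (l == 0))%:R.
  have sh m n : u (k - m) (l - n) = ip (X (- m) (- n)) (eta (- k) (- l)).
    by rewrite /u -(XE _ _ _ _ (- m) (- n)); congr (ip (X _ _) (eta _ _)); ring.
  have u0 : u k l = u (k - 0) (l - 0) by rewrite !subr0.
  have u1 : u (k - 1) l = u (k - 1) (l - 0) by rewrite !subr0.
  have u2 : u k (l - 1) = u (k - 0) (l - 1) by rewrite !subr0.
  rewrite u0 u1 u2 !sh oppr0.
  have e00 : eta 0 0 = X 0 0 - a *: X (-1) 0 - b *: X 0 (-1) - c *: X (-1) (-1).
    by rewrite /eta /ar_filter !sub0r.
  rewrite -!(ipZl ip_si) -!(ipNl ip_si) -!(ipDl ip_si) -e00 ew.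
  by rewrite !(eq_sym 0) !oppr_eq0; case: ifP.
pose S := `|a| + `|b| + `|c|; pose y := ip (X 0 0) (X 0 0).
have y0 : 0 <= y by exact: ip_ge0.
pose H n : R := \sum_(j < n) j.+1%:R^-1.
(* Here [y] comes from Cauchy-Schwarz, [6 * S] from the slope of the cutoff, 8 from [box_energy] and
   2 from [H N.+1 <= 2 * H N]. *)
suff HN N : (0 < N)%N -> H N <= y * (6 * S) ^+ 2 * 8 * 2.
  have [[|N] hN] := harmonic_unbounded (y * (6 * S) ^+ 2 * 8 * 2); last first.
    by have := HN N.+1 isT; rewrite leNgt hN.
  by move: hN; rewrite big_ord0 ltNge mulr_ge0 // mulr_ge0 // mulr_ge0 ?sqr_ge0.
move=> N0.
pose f k l := log_cutoff N (`|k| + `|l|)%N : R.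
pose v k l := g k l * f k l.
pose w k l := v k l - a * v (k + 1) l - b * v k (l + 1) - c * v (k + 1) (l + 1).
have v0 k l : (N <= `|k| + `|l|)%N -> v k l = 0.
  by move=> h; rewrite /v /f log_cutoff_ge ?mulr0.
have w_le (k l : int) : w k l ^+ 2 <= (6 * S) ^+ 2 * (`|k| + `|l|)%N.+1%:R^-1 ^+ 2.
  rewrite -exprMn -[leLHS]real_normK ?num_real //.
  rewrite ler_pXn2r ?nnegrE ?mulr_ge0 ?addr_ge0 ?invr_ge0 //.
  (* As [g] solves the adjoint recursion, only increments of [f] survive. *)
  have -> : w k l = a * (g (k + 1) l * (f k l - f (k + 1) l))
     + b * (g k (l + 1) * (f k l - f k (l + 1)))
     + c * (g (k + 1) (l + 1) * (f k l - f (k + 1) (l + 1))).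
    by rewrite /w /v {1}gE; ring.
  have st t (k' l' : int) : (`|k' - k| <= 1)%N -> (`|l' - l| <= 1)%N ->
      `|t * (g k' l' * (f k l - f k' l'))| <= `|t| * (6 / (`|k| + `|l|)%N.+1%:R).
    move=> hk hl; rewrite normrM ler_wpM2l // normrM.
    apply: (le_trans (ler_wpM2r _ (g1 k' l'))) => //; rewrite mul1r distrC.
    by apply: log_cutoff_step; lia.
  apply: (le_trans (ler_normD _ _)).
  apply: (le_trans (lerD (ler_normD _ _) (lexx _))).
  have h1 := st a (k + 1) l _ _; have h2 := st b k (l + 1) _ _.
  have h3 := st c (k + 1) (l + 1) _ _.
  apply: (le_trans (lerD (lerD (h1 _ _) (h2 _ _)) (h3 _ _))); try lia.
  by rewrite le_eqVlt; apply/orP; left; apply/eqP; rewrite /S; ring.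
pose n := (N + N.+1)%N.
pose z (p : 'I_n) : int := p%:Z - N%:Z.
pose W := \sum_(p : 'I_n * 'I_n) w (z p.1) (z p.2) *: eta (- z p.1) (- z p.2).
(* Summation by parts moves the filter onto [u], leaving a unit mass at the origin, which is the
   index [N] of the box. *)
have XW : ip (X 0 0) W = H N.
  rewrite /W (ip_sumr ip_si).
  under eq_bigr do rewrite (ipZr ip_si).
  rewrite -(pair_bigA _ (fun i j => w (z i) (z j) * ip (X 0 0) (eta (- z i) (- z j)))) /=.
  have := box_sum_adjoint a b c u v0; rewrite /box_sum => -> /=.
  have Nn : (N < n)%N by rewrite /n; lia.
  rewrite (bigD1 (Ordinal Nn)) //= (bigD1 (Ordinal Nn)) //= subrr uE !eqxx mulr1.
  rewrite !big1 ?addr0 => [|i iN|j jN].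
  - by rewrite /v /f g00 mul1r /log_cutoff /= big_mkord.
  - rewrite big1 // => j _; rewrite uE subr_eq0.
    rewrite (_ : (i%:Z == N%:Z) = false) ?mulr0 //.
    by apply: contraNF iN => /eqP[] iN; apply/eqP/val_inj.
  - rewrite uE eqxx subr_eq0.
    rewrite (_ : (j%:Z == N%:Z) = false) ?mulr0 //.
    by apply: contraNF jN => /eqP[] jN; apply/eqP/val_inj.
have WW : ip W W <= (6 * S) ^+ 2 * 8 * H N.+1.
  have orth (p q : 'I_n * 'I_n) : ip (eta (- z p.1) (- z p.2)) (eta (- z q.1) (- z q.2)) =
      if p == q then 1 else 0.
    rewrite ew !eqr_opp /z !(can_eq (addrK _)).
    by case: p q => [p1 p2] [q1 q2] /=; rewrite xpair_eqE.
  rewrite (ip_orthosum ip_si _ orth) mul1r.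
  rewrite -(pair_bigA _ (fun i j => w (z i) (z j) ^+ 2)) /=.
  apply: (@le_trans _ _ ((6 * S) ^+ 2 * box_sum N
      (fun k l => (`|k| + `|l|)%N.+1%:R^-1 ^+ 2))).
    rewrite /box_sum mulr_sumr; apply: ler_sum => i _.
    by rewrite mulr_sumr; apply: ler_sum => j _; apply: w_le.
  by rewrite -mulrA ler_wpM2l ?sqr_ge0 // box_energy.
have HS : H N.+1 <= 2 * H N.
  rewrite /H big_ord_recr /= mulrDl !mul1r lerD2l.
  case: N N0 {f v w v0 w_le n z W XW WW} => [//|m _].
  rewrite big_ord_recl /= invr1 (le_trans (y := 1)) //.
    by rewrite invf_le1 // ler1n.
  by rewrite lerDl sumr_ge0.
have HN0 : 0 < H N.
  case: N N0 {f v w v0 w_le n z W XW WW HS} => [//|m _].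
  by rewrite /H big_ord_recl ltr_wpDr ?sumr_ge0.
have := ip_cauchy_schwarz ip_si (X 0 0) W; rewrite XW -/y => h.
rewrite -(ler_pM2r HN0) -expr2; apply: (le_trans h).
apply: (le_trans (ler_wpM2l y0 WW)).
have K := ler_wpM2l (_ : 0 <= y * ((6 * S) ^+ 2 * 8)) HS.
rewrite mulrA; apply: (le_trans (K _)); first by rewrite mulr_ge0 // mulr_ge0 // sqr_ge0.
by rewrite le_eqVlt; apply/orP; left; apply/eqP; ring.
Qed.

End NoBoundedKernel.

(** * Zeros of the symbol on the torus *)

Section UnitRoot.
Context {R : rcfType}.

Lemma unit_complexP (x y : R) : x ^+ 2 + y ^+ 2 = 1 -> `|(x +i* y)%C| = 1.
Proof. by move=> xy; rewrite normc_def /= xy sqrtr1. Qed.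

(** Solving for z1 gives (1 - b z2) / (a + c z2), of modulus 1 when numerator and denominator have
    equal moduli. On |z2| = 1 this is a linear equation in x = Re z2, and the hypothesis provides a
    solution in [-1, 1]. *)
Lemma symbol_unit_root (a b c : R) :
    (1 + b ^+ 2 - a ^+ 2 - c ^+ 2) ^+ 2 <= 4 * (b + a * c) ^+ 2 ->
  exists z1 z2 : R[i], [/\ `|z1| = 1, `|z2| = 1 &
    1 = a%:C%C * z1 + b%:C%C * z2 + c%:C%C * (z1 * z2)].
Proof.
move=> hD.
have [x xE x1] : exists2 x, 1 + b ^+ 2 - a ^+ 2 - c ^+ 2 = 2 * (b + a * c) * x &
    x ^+ 2 <= 1.
  have [q0|q0] := eqVneq (b + a * c) 0.
    exists 1; last by rewrite expr1n.
    rewrite q0 expr0n mulr0 in hD; rewrite q0 !mulr0 mul0r.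
    by apply/eqP; rewrite -sqrf_eq0 eq_le hD sqr_ge0.
  exists ((1 + b ^+ 2 - a ^+ 2 - c ^+ 2) / (2 * (b + a * c))); first by field.
  rewrite expr_div_n ler_pdivrMr; first by rewrite mul1r exprMn; lra.
  by rewrite exprn_even_gt0 // mulf_neq0.
pose y := Num.sqrt (1 - x ^+ 2).
have xy : x ^+ 2 + y ^+ 2 = 1 by rewrite sqr_sqrtr ?subr_ge0 // addrC subrK.
pose z2 := (x +i* y)%C.
pose p := (1 - b%:C%C * z2)%C; pose q := (a%:C%C + c%:C%C * z2)%C.
have npq : `|p| = `|q|.
  rewrite !normc_def; congr (Num.sqrt _)%:C%C.
  rewrite /p /q /z2 /=.
  move: xy; rewrite -/y; clearbody y => xy.
  have yE : y ^+ 2 = 1 - x ^+ 2 by rewrite -xy; ring.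
  transitivity ((1 - b * x) ^+ 2 + b ^+ 2 * y ^+ 2); first by ring.
  transitivity ((a + c * x) ^+ 2 + c ^+ 2 * y ^+ 2); last by ring.
  by rewrite yE; lra.
have z2n : `|z2| = 1 by exact: unit_complexP.
(* If the denominator vanishes, so does the numerator, and any z1 will do. *)
have [q0|q0] := eqVneq q 0.
  exists 1, z2; split => //; first exact: normr1.
  have p0 : p = 0 by apply/eqP; rewrite -normr_eq0 npq q0 normr0.
  rewrite mulr1 mul1r addrAC -/q q0 add0r; apply/eqP; rewrite -subr_eq0.
  exact/eqP.
exists (p / q), z2; split => //.
  by rewrite normf_div npq divff // normr_eq0.
have -> : a%:C%C * (p / q) + b%:C%C * z2 + c%:C%C * (p / q * z2) =
  (a%:C%C + c%:C%C * z2) * (p / q) + b%:C%C * z2 by ring.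
by rewrite -/q mulrCA divff // mulr1 /p subrK.
Qed.

End UnitRoot.

Section Kernel.
Context {R : rcfType}.

Lemma bounded_kernel (a b c : R) :
    (1 + b ^+ 2 - a ^+ 2 - c ^+ 2) ^+ 2 <= 4 * (b + a * c) ^+ 2 ->
  exists g : int -> int -> R, [/\ g 0 0 = 1, forall k l, `|g k l| <= 1 &
   forall k l, g k l = a * g (k + 1) l + b * g k (l + 1)
                         + c * g (k + 1) (l + 1)].
Proof.
move=> /symbol_unit_root[z1 [z2 [n1 n2 zE]]].
have z10 : z1 != 0 by rewrite -normr_eq0 n1 oner_eq0.
have z20 : z2 != 0 by rewrite -normr_eq0 n2 oner_eq0.
have ReM (t : R) z : complex.Re (t%:C%C * z) = t * complex.Re z.
  by case: z => ? ?; rewrite /= mul0r subr0.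
exists (fun k l => complex.Re (z1 ^ k * z2 ^ l)); split => [|k l|k l].
- by rewrite !expr0z mulr1.
- rewrite -lecR; apply: (le_trans (normc_ge_Re _)).
  have norm1X (z : R[i]) m : `|z| = 1 -> `|z ^ m| = 1.
    by case: m => n nz; rewrite /exprz ?normfV normrX nz expr1n ?invr1.
  by rewrite normrM !norm1X // mulr1.
- rewrite !expfzDr //  -!ReM -!raddfD /=; congr complex.Re.
  rewrite -[LHS]mulr1 zE; ring.
Qed.

End Kernel.

(** * The causal expansion *)

Lemma exists_expr_lt {R : realType} (r C e : R) : 0 <= r < 1 -> 0 < e ->
  exists n, C * r ^+ n < e.
Proof.
move=> /andP[r0 r1] e0.
have : ((fun n => C * r ^+ n) @ \oo --> C * 0)%classic.
  by apply: cvgMr; apply: cvg_expr; rewrite ger0_norm.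
rewrite mulr0 => /cvgr_lt /(_ _ e0) [n _ h].
by exists n; apply: h => /=.
Qed.

Section Causal.
Context {R : realType} {V : lmodType R} (ip : V -> V -> R).
Hypothesis ip_si : semi_inner ip.
Context (a b c r s : R) (X : int -> int -> V).
Let eta := ar_filter a b c X.
Hypothesis XX : jointly_stationary ip X X.
Hypothesis eta_white : white ip s eta.
Hypothesis r01 : 0 <= r < 1.
Hypothesis a1 : `|a| < 1.
Hypothesis b1 : `|b| < 1.
Hypothesis acb1 : (a + c) ^+ 2 <= r * (1 - b) ^+ 2.
Hypothesis acb2 : (a - c) ^+ 2 <= r * (1 + b) ^+ 2.
Hypothesis bca1 : (b + c) ^+ 2 <= r * (1 - a) ^+ 2.
Hypothesis bca2 : (b - c) ^+ 2 <= r * (1 + a) ^+ 2.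

Definition ma_sum n i j : V :=
  \sum_(k < n) \sum_(l < n)
    green a b c k.+1 l.+1 *: eta (i - k%:Z) (j - l%:Z).

Definition ma_rest n i j : V := X i j - ma_sum n i j.

Lemma filtered_ma_rest n : filtered X (ma_rest n).
Proof.
apply: filteredB; first exact: filtered_id.
apply: (filtered_sum (F := fun k i j => \sum_(l < n)
  green a b c k.+1 l.+1 *: eta (i - k%:Z) (j - l%:Z))) => k.
apply: (filtered_sum (F := fun l i j =>
  green a b c k.+1 l.+1 *: eta (i - k%:Z) (j - l%:Z))) => l.
by apply/filteredZ/filteredS/filtered_ar; exact: filtered_id.
Qed.

(** The filter commutes with the convolution in [ma_sum], and the term [E 0 0] of [green_telescope]
    cancels [eta i j]. *)
Lemma ar_ma_rest n i j :
  let E k l := eta (i - k%:Z) (j - l%:Z) in let g := green a b c in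
  ar_filter a b c (ma_rest n.+1) i j =
   a *: (\sum_(l < n.+1) g n.+1 l.+1 *: E n.+1 l)
   + b *: (\sum_(k < n.+1) g k.+1 n.+1 *: E k n.+1)
   + c *: (\sum_(l < n.+1) g n.+1 l *: E n.+1 l)
   + c *: (\sum_(k < n.+1) g k.+1 n.+1 *: E k.+1 n.+1).
Proof.
move=> E g.
have -> : ar_filter a b c (ma_rest n.+1) i j = eta i j -
    (ma_sum n.+1 i j - a *: ma_sum n.+1 (i - 1) j - b *: ma_sum n.+1 i (j - 1)
     - c *: ma_sum n.+1 (i - 1) (j - 1)).
  rewrite {1}/ar_filter /ma_rest !scalerBr !opprB !addrA /eta {1}/ar_filter.
  by rewrite [RHS](ACl (1*8*7*2*6*3*5*4)).
have := green_telescope a b c E n; rewrite -/g /=.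
rewrite (_ : E 0 0 = eta i j); last by rewrite /E !subr0.
set B := (X in _ = eta i j - X) => tel; rewrite -[RHS](subKr (eta i j)) -tel.
congr (_ - _); rewrite /ma_sum !scaler_sumr -!sumrB.
apply: eq_bigr => k _; rewrite !scaler_sumr -!sumrB; apply: eq_bigr => l _.
rewrite !scalerBr !scalerA !(mulrC (green _ _ _ _ _)) /E.
have sh (m : int) (p : nat) : m - 1 - p%:Z = m - (p.+1)%:Z by rewrite intS; ring.
by rewrite !sh.
Qed.

Lemma ma_rest_small e : 0 < e ->
  exists n, forall i j, ip (ma_rest n i j) (ma_rest n i j) < e.
Proof.
move=> e0.
have /andP[r0 r1] := r01.
have s0 : 0 <= s by have := ip_ge0 ip_si (eta 0 0); rewrite eta_white !eqxx.
pose Ka := (1 - `|a|) ^+ 2; pose Kb := (1 - `|b|) ^+ 2.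
have Ka0 : 0 < Ka by rewrite exprn_gt0 // subr_gt0.
have Kb0 : 0 < Kb by rewrite exprn_gt0 // subr_gt0.
pose K := ((1 - `|b|) * (1 - r) / 2) ^+ 2.
have K0 : 0 < K by rewrite exprn_gt0 // divr_gt0 // mulr_gt0 // subr_gt0.
(* The factor 4 is that of [ip_sumsq4]; [Kb] serves the last row and [Ka] the last column. *)
pose M := 4 * (s * (a ^+ 2 + c ^+ 2) / Kb + s * (b ^+ 2 + c ^+ 2) / Ka).
have [n hn] := exists_expr_lt (M / K) r01 e0.
exists n.+1 => i j; apply: le_lt_trans hn.
rewrite mulrAC ler_pdivlMr // mulrC.
have YY := filtered_stationary ip_si XX (filtered_ma_rest n.+1).
apply: le_trans (ar_coercive ip_si r01 b1 acb1 acb2 YY i j) _.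
rewrite ar_ma_rest; apply: le_trans (ip_sumsq4 ip_si _ _ _ _) _.
have intB (m : int) (p q : nat) : (m - p%:Z == m - q%:Z) = (p == q).
  by rewrite (can_eq (subKr m)).
pose E k l := eta (i - k%:Z) (j - l%:Z).
have EE k l k' l' : ip (E k l) (E k' l') = if (k == k') && (l == l') then s else 0.
  by rewrite eta_white !intB.
have row k l l' : ip (E k l) (E k l') = if l == l' then s else 0.
  by rewrite EE eqxx.
have col l k k' : ip (E k l) (E k' l) = if k == k' then s else 0.
  by rewrite EE eqxx andbT.
have colS l k k' : ip (E k.+1 l) (E k'.+1 l) = if k == k' then s else 0.
  exact: col.
rewrite !(ipZl ip_si) !(ipZr ip_si).
rewrite !(ip_orthosum ip_si _ (fun l l' : 'I_n.+1 => row _ l l')).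
rewrite (ip_orthosum ip_si _ (fun l l' : 'I_n.+1 => col _ l l')).
rewrite (ip_orthosum ip_si _ (fun l l' : 'I_n.+1 => colS _ l l')).
have H1 := green_row_bound n n.+1 r0 b1 acb1 acb2.
have H2 := green_row_bound_shift n n.+1 r0 b1 acb1 acb2.
(* Columns are rows after exchanging [a] and [b]. *)
have H3 := green_row_bound n n.+1 r0 a1 bca1 bca2.
move: H3; under eq_bigr do rewrite green_sym.
rewrite -/Ka -/Kb in H1 H2 * => H3.
rewrite mulrC -ler_pdivlMr // in H1; rewrite mulrC -ler_pdivlMr // in H2.
rewrite mulrC -ler_pdivlMr // in H3.
move: H1 H2 H3; set S1 := \sum_(l < _) _; set S2 := \sum_(l < _) _.
set S3 := \sum_(l < _) _ => H1 H2 H3.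
have -> : M * r ^+ n = 4 * (a * (a * (s * (r ^+ n / Kb))) + b * (b * (s * (r ^+ n / Ka)))
   + c * (c * (s * (r ^+ n / Kb))) + c * (c * (s * (r ^+ n / Ka)))).
  by rewrite /M; ring.
have mono t x y : x <= y -> t * (t * (s * x)) <= t * (t * (s * y)).
  by move=> xy; rewrite !(mulrA t t) -expr2 ler_wpM2l ?sqr_ge0 // ler_wpM2l.
by rewrite ler_wpM2l //; do !apply: lerD; apply: mono.
Qed.

(** The sum [ma_sum] at (k, l) never involves [eta i j], so only the pairing with the small
    remainder is left. *)
Lemma ip_innovation_past i j k l : (k < i) || (l < j) -> ip (eta i j) (X k l) = 0.
Proof.
move=> kl; apply: contraTeq isT => nz.
have s0 : 0 <= s by have := ip_ge0 ip_si (eta 0 0); rewrite eta_white !eqxx.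
pose x := ip (eta i j) (X k l).
have x0 : 0 < x ^+ 2 by rewrite exprn_even_gt0.
(* Dividing by [s + 1] covers the case [s = 0]. *)
have [n hn] := ma_rest_small (divr_gt0 x0 (ltr_pwDr ltr01 s0)).
have xE : x = ip (eta i j) (ma_rest n k l).
  rewrite /ma_rest (ipDr ip_si) (ipNr ip_si) (ip_sumr ip_si) big1 ?subr0 // => p _.
  rewrite (ip_sumr ip_si) big1 // => q _; rewrite (ipZr ip_si) eta_white ifF ?mulr0 //.
  have gtB (m m' : int) (p' : nat) : m' < m -> (m == m' - p'%:Z) = false.
    by move=> mm; rewrite gt_eqF // (le_lt_trans _ mm) // gerBl.
  by case/orP: kl => /gtB ->; rewrite ?andbF.
have := ip_cauchy_schwarz ip_si (eta i j) (ma_rest n k l).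
rewrite -xE eta_white !eqxx /= => h.
have : s * ip (ma_rest n k l) (ma_rest n k l) < x ^+ 2.
  apply: le_lt_trans (ler_wpM2l s0 (ltW (hn k l))) _.
  by rewrite mulrCA gtr_pMr // ltr_pdivrMr ?ltr_wpDl // mul1r ltrDl.
by rewrite ltNge h.
Qed.

End Causal.

(** * Reduction to a stable filter *)

Section Coefficients.
Context {R : realFieldType}.

(* The difference of the two sides of the first hypothesis is the product of
   the values 1 - a - b - c, 1 - a + b + c, 1 + a - b + c and 1 + a + b - c of
   the symbol at the real points of the torus. *)
Lemma symbol_sign_cases (a b c : R) :
    4 * (b + a * c) ^+ 2 < (1 + b ^+ 2 - a ^+ 2 - c ^+ 2) ^+ 2 ->
    a ^+ 2 + b ^+ 2 < 1 + c ^+ 2 ->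
  [/\ 0 < 1 - a - b - c, 0 < 1 - a + b + c, 0 < 1 + a - b + c & 0 < 1 + a + b - c]
  \/ [/\ 1 - a - b - c < 0, 0 < 1 - a + b + c, 0 < 1 + a - b + c & 1 + a + b - c < 0]
  \/ [/\ 0 < 1 - a - b - c, 1 - a + b + c < 0, 1 + a - b + c < 0 & 0 < 1 + a + b - c].
Proof.
move=> hD h0.
set x0 := 1 - a - b - c; set x1 := 1 - a + b + c.
set x2 := 1 + a - b + c; set x3 := 1 + a + b - c.
have D : 0 < (x0 * x3) * (x1 * x2).
  by move: hD; rewrite -subr_gt0 /x0 /x1 /x2 /x3; congr (0 < _); ring.
(* The sum is 2 (1 + c^2 - a^2 - b^2); two numbers with positive product and positive sum are
   positive. *)
have S : 0 < x0 * x3 + x1 * x2 by rewrite /x0 /x1 /x2 /x3; lra.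
have [P1 P2] : 0 < x0 * x3 /\ 0 < x1 * x2.
  by have [p|p] := ltrP 0 (x0 * x3); [split=> //; rewrite -(pmulr_rgt0 _ p)|]; nra.
(* Excludes four negative values. *)
have T : x0 + x1 + x2 + x3 = 4 by rewrite /x0 /x1 /x2 /x3; ring.
have sg (x y : R) : 0 < x * y -> (0 < x /\ 0 < y) \/ (x < 0 /\ y < 0).
  have [x0'|x0'|->] := ltrgt0P x; last by rewrite mul0r ltxx.
    by rewrite pmulr_rgt0 //; left.
  by rewrite nmulr_rgt0 //; right.
case: (sg _ _ P1) => [[y0 y3]|[y0 y3]]; case: (sg _ _ P2) => [[y1 y2]|[y1 y2]].
- by left.
- by right; right.
- by right; left.
- by exfalso; move: T y0 y1 y2 y3; clear; lra.
Qed.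

(** For [r < 1], a quantitative absence of zeros of phi in the closed bidisc, tested at the points 1
    and -1 of each circle. *)
Definition stable (a b c r : R) :=
  [/\ `|a| < 1, `|b| < 1,
      (a + c) ^+ 2 <= r * (1 - b) ^+ 2 /\ (a - c) ^+ 2 <= r * (1 + b) ^+ 2 &
      (b + c) ^+ 2 <= r * (1 - a) ^+ 2 /\ (b - c) ^+ 2 <= r * (1 + a) ^+ 2].

(** The hypotheses say |a + c| < 1 - b, |a - c| < 1 + b, |b + c| < 1 - a and |b - c| < 1 + a; [r] is
    the largest squared ratio. *)
Lemma exists_stable (a b c : R) : 0 < 1 - a - b - c -> 0 < 1 - a + b + c ->
  0 < 1 + a - b + c -> 0 < 1 + a + b - c -> exists2 r, 0 <= r < 1 & stable a b c r.
Proof.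
move=> h0 h1 h2 h3.
have ratio (x y : R) : `|x| < y ->
    exists2 r, 0 <= r < 1 & forall r', r <= r' -> x ^+ 2 <= r' * y ^+ 2.
  move=> xy; have y0 : 0 < y by apply: le_lt_trans xy.
  exists (x ^+ 2 / y ^+ 2) => [|r'].
    apply/andP; split; first by rewrite divr_ge0 ?sqr_ge0.
    rewrite ltr_pdivrMr ?exprn_gt0 // mul1r.
    by rewrite -(real_normK (num_real x)) ltrXn2r.
  by rewrite ler_pdivrMr ?exprn_gt0.
have [|r1 /andP[p1 q1] H1] := ratio (a + c) (1 - b); first by rewrite ltr_norml; lra.
have [|r2 /andP[p2 q2] H2] := ratio (a - c) (1 + b); first by rewrite ltr_norml; lra.
have [|r3 /andP[p3 q3] H3] := ratio (b + c) (1 - a); first by rewrite ltr_norml; lra.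
have [|r4 /andP[p4 q4] H4] := ratio (b - c) (1 + a); first by rewrite ltr_norml; lra.
exists (Num.max (Num.max r1 r2) (Num.max r3 r4)).
  by rewrite !le_max !gt_max p1 q1 q2 q3 q4.
split; [rewrite ltr_norml; lra|rewrite ltr_norml; lra| |].
- by split; [apply: H1|apply: H2]; rewrite !le_max lexx ?orbT.
- by split; [apply: H3|apply: H4]; rewrite !le_max lexx ?orbT.
Qed.

End Coefficients.

Section Reversal.
Context {R : realFieldType} {V : lmodType R} (ip : V -> V -> R).
Hypothesis ip_si : semi_inner ip.

(** The coefficients are those of |phi|^2 on the torus. *)
Lemma ar_cov (a b c : R) X i j k l : jointly_stationary ip X X ->
  let v m n := ip (X m n) (X 0 0) in let m := i - k in let n := j - l in
  ip (ar_filter a b c X i j) (ar_filter a b c X k l) =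
  (1 + a ^+ 2 + b ^+ 2 + c ^+ 2) * v m n
  + (b * c - a) * (v (m - 1) n + v (m + 1) n)
  + (a * c - b) * (v m (n - 1) + v m (n + 1))
  - c * (v (m - 1) (n - 1) + v (m + 1) (n + 1))
  + a * b * (v (m - 1) (n + 1) + v (m + 1) (n - 1)).
Proof.
move=> XX v m n.
have vE p q p' q' : ip (X p q) (X p' q') = v (p - p') (q - q').
  by have := XX (p - p') (q - q') 0 0 p' q'; rewrite !add0r !subrK.
have s1 (x y : int) : x - 1 - (y - 1) = x - y by ring.
have s2 (x y : int) : x - (y - 1) = x - y + 1 by ring.
have s3 (x y : int) : x - 1 - y = x - y - 1 by ring.
by rewrite /ar_filter !(ipE ip_si) !vE !s1 !s2 !s3 -/m -/n; ring.
Qed.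

(* The symbol of the new filter is, up to the factor c, the conjugate of the
   old one times a monomial, so both have the same modulus on the torus. *)
Lemma white_reversal (a b c : R) X : c != 0 -> jointly_stationary ip X X ->
  white ip 1 (ar_filter a b c X) ->
  white ip (c ^- 2) (ar_filter (- b / c) (- a / c) c^-1 X).
Proof.
move=> c0 XX ew i j k l; have := ew i j k l; rewrite !ar_cov // => e.
transitivity (c ^- 2 * if (i == k) && (j == l) then 1 else 0); last first.
  by case: ifP; rewrite ?mulr1 ?mulr0.
by rewrite -e; field.
Qed.

End Reversal.

Theorem causal_representation (R : realType) (V : lmodType R) (ip : V -> V -> R)
    (a b c : R) (X : int -> int -> V) : semi_inner ip ->
    jointly_stationary ip X X -> white ip 1 (ar_filter a b c X) ->
    a ^+ 2 + b ^+ 2 < 1 + c ^+ 2 ->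
  exists a' b' c', let xi := ar_filter a' b' c' X in
    (forall i j k l, (k < i) || (l < j) -> ip (xi i j) (X k l) = 0) /\
    (forall e, 0 < e -> exists n, forall i j,
       let Z := X i j - ma_sum a' b' c' X n i j in ip Z Z < e).
Proof.
move=> ip_si XX ew abc.
have D : 4 * (b + a * c) ^+ 2 < (1 + b ^+ 2 - a ^+ 2 - c ^+ 2) ^+ 2.
  rewrite ltNge; apply/negP => /bounded_kernel[g [g0 g1 gE]].
  exact: (no_bounded_kernel ip_si XX ew g1 gE g0).
have main a' b' c' s : white ip s (ar_filter a' b' c' X) ->
    0 < 1 - a' - b' - c' -> 0 < 1 - a' + b' + c' ->
    0 < 1 + a' - b' + c' -> 0 < 1 + a' + b' - c' ->
  exists a' b' c', let xi := ar_filter a' b' c' X in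
    (forall i j k l, (k < i) || (l < j) -> ip (xi i j) (X k l) = 0) /\
    (forall e, 0 < e -> exists n, forall i j,
       let Z := X i j - ma_sum a' b' c' X n i j in ip Z Z < e).
  move=> w h0 h1 h2 h3.
  have [r r01 [a1 b1 [u1 u2] [u3 u4]]] := exists_stable h0 h1 h2 h3.
  exists a', b', c'; split=> [i j k l|e e0].
    exact: (ip_innovation_past ip_si XX w r01 a1 b1 u1 u2 u3 u4).
  have [n hn] := ma_rest_small ip_si XX w r01 a1 b1 u1 u2 u3 u4 e0.
  by exists n.
have [[h0 h1 h2 h3]|h] := symbol_sign_cases D abc; first exact: (main a b c 1).
(* These quotients are the values of the reversed symbol at the real points of the torus. *)
have [c0 pos] : c != 0 /\ [/\ 0 < - (1 - a - b - c) / c, 0 < (1 - a + b + c) / c,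
    0 < (1 + a - b + c) / c & 0 < - (1 + a + b - c) / c].
  case: h => [[h0 h1 h2 h3]|[h0 h1 h2 h3]].
    have c0 : 0 < c by lra.
    by split; [rewrite gt_eqF | split; rewrite divr_gt0 // oppr_gt0].
  have c0 : c < 0 by lra.
  by split; [rewrite lt_eqF | split; rewrite nmulr_rgt0 ?invr_lt0 // oppr_lt0].
case: pos => h0 h1 h2 h3.
apply: (main _ _ _ _ (white_reversal ip_si c0 XX ew)).
- by rewrite [X in 0 < X](_ : _ = - (1 - a - b - c) / c) //; field.
- by rewrite [X in 0 < X](_ : _ = (1 - a + b + c) / c) //; field.
- by rewrite [X in 0 < X](_ : _ = (1 + a - b + c) / c) //; field.
- by rewrite [X in 0 < X](_ : _ = - (1 + a + b - c) / c) //; field.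
Qed.

(** * Square-integrable random variables *)

Section L2.
Context {d : measure_display} {T : measurableType d} {R : realType}.
Variable P : probability T R.

Lemma le1_2e : (1 <= 2%:E :> \bar R)%E.
Proof. by rewrite lee_fin ler1n. Qed.

Local Notation L2 := (LfunType P le1_2e).

Definition L2_ip (f g : L2) : R := fine ('E_P[(f : T -> R) * g])%E.

Lemma L2_mul_Lfun1 (f g : L2) : (f : T -> R) * g \in Lfun P 1.
Proof. by apply: Lfun2_mul_Lfun1; exact: LfunP. Qed.

Lemma L2_ipE (f g : L2) : ((L2_ip f g)%:E = 'E_P[(f : T -> R) * g])%E.
Proof. by rewrite fineK // expectation_fin_num // L2_mul_Lfun1. Qed.

Lemma L2_ip_semi_inner : semi_inner L2_ip.
Proof.
split=> [f g|t f g h|f].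
- by rewrite /L2_ip mulrC.
- apply: EFin_inj; rewrite [RHS]EFinD (EFinM t (L2_ip f h)) !L2_ipE.
  rewrite -expectationZl ?L2_mul_Lfun1 //.
  rewrite -expectationD ?Lfun_scale ?L2_mul_Lfun1 //.
  congr ('E_P[_])%E; apply/funext => w.
  by rewrite /= !fctE /= -[t *: f w]/(t * f w); ring.
- rewrite -lee_fin L2_ipE; apply: expectation_ge0 => w.
  by rewrite fctE -expr2 sqr_ge0.
Qed.

Lemma L2_norm_lt (f : L2) e : 0 < e ->
  ('N[P]_2%:E[EFin \o f] < e%:E)%E = (L2_ip f f < e ^+ 2).
Proof.
move=> e0; have := finite_norm_fine f; set r := fine _ => <-.
have r0 : 0 <= r by rewrite fine_ge0 ?Lnorm_ge0.
have -> : L2_ip f f = r ^+ 2.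
  apply: EFin_inj; rewrite L2_ipE -powR_mulrn // -poweR_EFin finite_norm_fine.
  rewrite poweR_Lnorm // unlock; apply: eq_integral => w _.
  by rewrite /= fctE powR_mulrn // real_normK ?num_real.
by rewrite lte_fin ltr_pXn2r ?nnegrE ?(ltW e0).
Qed.

Lemma closed_subspaceD V (f g : T -> R) t : closed_subspace P V ->
  V f -> V g -> V (t *: f + g).
Proof.
move=> [_ [_ h] _] Vf Vg; have := h t f g; rewrite !inE; exact.
Qed.

Lemma closed_subspace0 V : closed_subspace P V -> V 0.
Proof. by move=> [_ [+ _] _]; rewrite inE. Qed.

Lemma closed_subspace_sum V (I : finType) (c : I -> R) (F : I -> L2) :
  closed_subspace P V -> (forall i, V (F i)) -> V (\sum_i c i *: F i : L2).
Proof.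
move=> cV VF; apply: (big_ind (fun f : L2 => V f)) => [|f g Vf Vg|i _].
- exact: closed_subspace0.
- by have := closed_subspaceD 1 cV Vf Vg; rewrite scale1r.
- by have := closed_subspaceD (c i) cV (VF i) (closed_subspace0 cV); rewrite addr0.
Qed.

Lemma closed_subspace_ar V (a b c : R) (X : int -> int -> L2) i j :
  closed_subspace P V -> V (X i j) -> V (X (i - 1) j) -> V (X i (j - 1)) ->
  V (X (i - 1) (j - 1)) -> V (ar_filter a b c X i j).
Proof.
move=> cV h1 h2 h3 h4.
have := closed_subspaceD (- c) cV h4 (closed_subspaceD (- b) cV h3
  (closed_subspaceD (- a) cV h2 h1)).
rewrite (_ : ar_filter a b c X i j = - c *: X (i - 1) (j - 1) +
  (- b *: X i (j - 1) + (- a *: X (i - 1) j + X i j))) //.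
by rewrite !addrA !scaleNr [RHS](ACl (4*3*2*1)).
Qed.

(** Extends orthogonality from generators to their closed span; closedness is Cauchy-Schwarz. *)
Lemma closed_subspace_orthogonal (f : L2) :
  closed_subspace P [set g : T -> R |
    g \in Lfun P 2%:E /\ ('E_P[(f : T -> R) * g] = 0)%E].
Proof.
have toip g (Lg : g \in Lfun P 2%:E) :
    ('E_P[(f : T -> R) * g] = 0)%E <-> L2_ip f (Lfun_Sub le1_2e Lg) = 0.
  rewrite -[g in X in X <-> _](Lfun_valP le1_2e Lg) -L2_ipE.
  by split=> [[]|->].
have si := L2_ip_semi_inner.
split=> [g []//|| g Lg h].
- split=> [|t u v]; rewrite !inE /=.
    split; first exact: (LfunP (0 : L2)).
    by rewrite mulr0 expectation_cst.
  move=> [Lu fu] [Lv fv].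
  have -> : t *: u + v = (t *: Lfun_Sub le1_2e Lu + Lfun_Sub le1_2e Lv : L2) :> (T -> R).
    by [].
  split; first exact: LfunP.
  rewrite -L2_ipE (ipDr si) (ipZr si).
  by rewrite (iffLR (toip _ Lu) fu) (iffLR (toip _ Lv) fv) mulr0 addr0.
- split=> //; apply/(toip _ Lg); set g' := Lfun_Sub _ _.
  apply: contrapT => /eqP nz.
  pose x := L2_ip f g'.
  have x0 : 0 < x ^+ 2 by rewrite exprn_even_gt0.
  have s0 := ip_ge0 si f.
  have e2 : 0 < x ^+ 2 / (L2_ip f f + 1) by rewrite divr_gt0 // ltr_wpDl.
  have e0 : 0 < Num.sqrt (x ^+ 2 / (L2_ip f f + 1)) by rewrite sqrtr_gt0.
  have [u [Lu fu]] := h _ e0.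
  rewrite -[g \- u]/((g' - Lfun_Sub le1_2e Lu : L2) : T -> R).
  rewrite L2_norm_lt // sqr_sqrtr ?(ltW e2) // => lt.
  have xE : x = L2_ip f (g' - Lfun_Sub le1_2e Lu).
    by rewrite (ipDr si) (ipNr si) (iffLR (toip _ Lu) fu) subr0.
  have := ip_cauchy_schwarz si f (g' - Lfun_Sub le1_2e Lu); rewrite -xE leNgt.
  case/negP; apply: le_lt_trans (ler_wpM2l s0 (ltW lt)) _.
  by rewrite mulrCA gtr_pMr // ltr_pdivrMr ?ltr_wpDl // mul1r ltrDl.
Qed.

End L2.

(** * Innovation spaces *)

Section Innovations.
Context {d : measure_display} {T : measurableType d} {R : realType}.
Variable P : probability T R.
Local Notation L2 := (LfunType P le1_2e).

Lemma L2_ip_cov (f g : L2) :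
  L2_ip f g = fine (covariance P f g) + fine ('E_P[f])%E * fine ('E_P[g])%E.
Proof.
have L21 (h : L2) : (h : T -> R) \in Lfun P 1.
  by apply: Lfun_subset12; [exact: fin_num_measure|exact: LfunP].
rewrite covarianceE ?L2_mul_Lfun1 //.
rewrite fineB ?fin_numM ?expectation_fin_num ?L2_mul_Lfun1 //.
by rewrite fineM ?expectation_fin_num // subrK.
Qed.

(** Needed because the model equation holds only almost surely. *)
Lemma L2_ip_ae (f f' g g' : L2) : {ae P, forall w, f w = f' w} ->
  {ae P, forall w, g w = g' w} -> L2_ip f g = L2_ip f' g'.
Proof.
move=> ff gg; rewrite /L2_ip unlock; congr fine; apply: ae_eq_integral => //.
- have /Lfun1_integrable/integrableP[] // := L2_mul_Lfun1 f g.
- have /Lfun1_integrable/integrableP[] // := L2_mul_Lfun1 f' g'.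
- by apply: filterS2 ff gg => w /= fw gw _; rewrite !fctE fw gw.
Qed.

(** The filter at (i, j) only uses indices in both half-planes r <= i and s <= j. *)
Lemma innovation_mem (X : int -> int -> {RV P >-> R}) (Y : int -> int -> L2) a b c i j :
    (forall i j, Y i j = X i j :> (T -> R)) ->
    (forall k l, (k < i) || (l < j) -> L2_ip (ar_filter a b c Y i j) (Y k l) = 0) ->
  innovation_space X i j (ar_filter a b c Y i j).
Proof.
move=> YX orth; set f := ar_filter a b c Y i j.
have mem (D : int -> int -> Prop) : D i j -> D (i - 1) j -> D i (j - 1) ->
    D (i - 1) (j - 1) -> field_span X D f.
  move=> h1 h2 h3 h4 W [cW sW].
  have WY r s : D r s -> W (Y r s) by move=> Drs; rewrite YX; apply: sW; exists r, s.
  by apply: (closed_subspace_ar _ _ _ cW); apply: WY.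
have ort (D : int -> int -> Prop) : (forall k l, D k l -> (k < i) || (l < j)) ->
    orthocompl P (field_span X D) f.
  move=> hD; split; first exact: LfunP.
  move=> g hg; suff [] : [set g : T -> R | g \in Lfun P 2%:E /\
    ('E_P[(f : T -> R) * g] = 0)%E] g by [].
  apply: hg; split; first exact: closed_subspace_orthogonal.
  move=> h [k [l [Dkl ->]]].
  split; rewrite -YX; first exact: LfunP.
  by rewrite -L2_ipE orth // hD.
have lt1 (m : int) : m - 1 < m by rewrite gtrBl.
have le1 (m : int) : m - 1 <= m by rewrite ltW.
split; [split; [split|]|].
- exact: mem.
- by apply: ort => k l ->.
- exact: mem.
- by apply: ort => k l ->; rewrite orbT.
Qed.

Lemma field_span_innovations (X : int -> int -> {RV P >-> R}) :
  cspan P [set f | exists i j, innovation_space X i j f] `<=`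
  field_span X (fun r s => True).
Proof.
move=> f hf W [cW sW]; apply: hf; split=> // g [i [j [[[+ _] _] _]]].
apply; split=> // h [r [s [_ ->]]]; apply: sW.
by exists r, s.
Qed.

End Innovations.

(** * Pure nondeterminism *)

Theorem proposition14 (d : measure_display) (T : measurableType d)
    (R : realType) (P : probability T R) (a b c : R)
    (X eps : int -> int -> {RV P >-> R})
    (X_wss : wide_sense_stationary X)
    (eps_wn : white_noise eps)
    (X_eq : forall i j : int, {ae P, forall w,
       X i j w = a * X (i - 1) j w + b * X i (j - 1) w
                 + c * X (i - 1) (j - 1) w + eps i j w})
    (abc : a ^+ 2 + b ^+ 2 < 1 + c ^+ 2) :
  purely_nondeterministic X.
Proof.
have [X2 Xmean Xcov] := X_wss; have [e2 emean evar ecov] := eps_wn.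
have si := L2_ip_semi_inner P.
pose Y i j := Lfun_Sub (le1_2e (R := R)) (X2 i j).
pose e i j := Lfun_Sub (le1_2e (R := R)) (e2 i j).
have YY : jointly_stationary (@L2_ip _ _ _ P) Y Y.
  move=> i j k l m n; rewrite !L2_ip_cov /=.
  rewrite !(Xmean _ _ 0 0); congr (fine _ + _).
  have := Xcov (i - k) (j - l) (i + m) (j + n) i j.
  rewrite !subKr => <-; congr (covariance P (X _ _) (X _ _)); ring.
have ew : white (@L2_ip _ _ _ P) 1 (ar_filter a b c Y).
  move=> i j k l.
  have ae p q : {ae P, forall w, ar_filter a b c Y p q w = e p q w}.
    apply: filterS (X_eq p q) => w Xw.
    rewrite (_ : ar_filter a b c Y p q w =
      X p q w - a * X (p - 1) q w - b * X p (q - 1) w - c * X (p - 1) (q - 1) w) //.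
    by rewrite Xw /e /=; ring.
  rewrite (L2_ip_ae (ae i j) (ae k l)) L2_ip_cov /= !emean mulr0 addr0.
  case: ifPn => [/andP[/eqP <- /eqP <-]|ne]; first by rewrite [X in fine X]evar.
  rewrite ecov // => -[ik jl]; by rewrite ik jl !eqxx in ne.
have [a' [b' [c' [orth small]]]] := causal_representation si YY ew abc.
apply/seteqP; split; last exact: field_span_innovations.
(* By minimality of the span it suffices that each [X r s] lies in every closed subspace [W]
   containing the innovation spaces; it is a limit of [ma_sum]. *)
move=> f hf W [cW sW]; apply: hf; split=> // g [r [s [_ ->]]].
have xiW i j : W (ar_filter a' b' c' Y i j).
  by apply: sW; exists i, j; apply: innovation_mem => // k l; apply: orth.
have [_ _ clW] := cW; apply: clW => // eta eta0.
have [n hn] := small _ (exprn_gt0 2 eta0).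
exists (ma_sum a' b' c' Y n r s); last first.
  exact: (etrans (L2_norm_lt (Y r s - ma_sum a' b' c' Y n r s) eta0) (hn r s)).
rewrite /ma_sum pair_bigA /=.
exact: (closed_subspace_sum _ cW (fun p => xiW _ _)).
Qed.
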